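(* Let $(M,\varphi,\xi,\eta,g)$ be a contact pseudo-metric manifold, let $h=\frac12\pounds_\xi\varphi$, and let $\ell$ be the $(1,1)$ tensor field $\ell X=R(X,\xi)\xi$. If $\nabla_\xi h=0$ and $\nabla\ell=0$, then all $\xi$-sectional curvatures of $M$ vanish, i.e. $K(\xi,X)=0$ for every unit vector $X\in\mathrm{Ker}\,\eta$.
   Context: An almost contact pseudo-metric manifold $(M,\varphi,\xi,\eta,g)$ is a smooth connected manifold $M$ of dimension $2n+1$ with a $(1,1)$ tensor field $\varphi$, a vector field $\xi$, a $1$-form $\eta$ and a pseudo-Riemannian metric $g$ such that $\varphi^2=-I+\eta\otimes\xi$, $\eta(\xi)=1$, $\varphi\xi=0$, $\eta\circ\varphi=0$, and $g(\varphi X,\varphi Y)=g(X,Y)-\varepsilon\eta(X)\eta(Y)$ for all $X,Y$, where $\varepsilon=\pm1$ is a fixed sign; this condition is equivalent to $\eta(X)=\varepsilon g(X,\xi)$ together with $g(\varphi X,Y)=-g(X,\varphi Y)$, and so $g(\xi,\xi)=\varepsilon$. It is a contact pseudo-metric manifold if $d\eta=\Phi$, where $\Phi(X,Y)=g(X,\varphi Y)$ and $d\eta(X,Y)=\frac12\big(X\eta(Y)-Y\eta(X)-\eta([X,Y])\big)$. $\nabla$ is the Levi-Civita connection of $g$, $R(X,Y)=[\nabla_X,\nabla_Y]-\nabla_{[X,Y]}$, $\pounds$ is the Lie derivative, and $(\nabla_XA)Y=\nabla_X(AY)-A(\nabla_XY)$ for a $(1,1)$ tensor $A$. For $X\in\mathrm{Ker}\,\eta$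 with $g(X,X)=\varepsilon_X=\pm1$ (a unit vector), the $\xi$-sectional curvature is $K(\xi,X)=\varepsilon\,\varepsilon_X\,g(R(\xi,X)X,\xi)$. *)

(* Defs.v *)
From HB Require Import structures.
From mathcomp Require Import all_boot all_order all_algebra.
From mathcomp Require Import all_classical all_reals all_analysis.
From mathcomp Require Import ring.

Set Implicit Arguments.
Unset Strict Implicit.
Unset Printing Implicit Defensive.

Import Order.TTheory GRing.Theory Num.Theory.
Import numFieldNormedType.Exports.
Local Open Scope classical_set_scope.
Local Open Scope ring_scope.

Section Cinfty.
Context {R : realType} {m : nat}.
Implicit Types (U : set 'rV[R]_m) (f g : 'rV[R]_m -> R).

Definition continuous_on U f := forall x, U x -> {for x, continuous f}.

Definition partial (i : 'I_m) f : 'rV[R]_m -> R :=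
  fun x => 'D_(delta_mx 0 i) f x.

(* Only used with U open. *)
Fixpoint Ck (k : nat) U f : Prop :=
  if k is k'.+1 then
    continuous_on U f /\
    forall i : 'I_m, (forall x, U x -> derivable f x (delta_mx 0 i)) /\
                     Ck k' U (partial i f)
  else continuous_on U f.

Definition Cinfty_on U f := forall k, Ck k U f.

Lemma CkW k U f : Ck k.+1 U f -> Ck k U f.
Proof.
elim: k f => [|k IH] f /= [cf df] //; split => // i.
by have [d1 d2] := df i; split => //; apply: IH.
Qed.

Lemma Ck_continuous k U f : Ck k U f -> continuous_on U f.
Proof. by case: k => [//|k] []. Qed.

Lemma eq_Ck k U f g : open U -> (forall x, U x -> f x = g x) ->
  Ck k U f -> Ck k U g.
Proof.
move=> oU; have eqnear (f1 g1 : 'rV[R]_m -> R) x :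
    (forall x, U x -> f1 x = g1 x) -> U x -> \near x, f1 x = g1 x.
  by move=> e Ux; apply: filterS e _; exact: open_nbhs_nbhs.
have cont (f1 g1 : 'rV[R]_m -> R) : (forall x, U x -> f1 x = g1 x) ->
    continuous_on U f1 -> continuous_on U g1.
  move=> e cf x Ux; rewrite /prop_for /continuous_at -(e x Ux).
  apply: cvg_trans (cf x Ux).
  exact: (near_eq_cvg (F := nbhs x)) (eqnear _ _ _ e Ux).
elim: k f g => [|k IH] f g e /=; first exact: cont.
move=> [cf df]; split; first exact: cont cf.
move=> i; have [d1 d2] := df i; split.
  move=> x Ux; apply: near_eq_derivable (d1 x Ux); exact: eqnear.
apply: IH d2 => x Ux; apply: near_eq_derive; exact: eqnear.
Qed.

Lemma Ck_cst k U (c : R) : Ck k U (fun=> c).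
Proof.
have cc (c' : R) : continuous_on U (fun=> c') by move=> x _; exact: cst_continuous.
elim: k c => [|k IH] c //=; split => // i; split.
  by move=> x _; exact: derivable_cst.
have -> : partial i (fun=> c) = fun=> 0.
  by apply/funext => x; rewrite /partial; exact: derive_cst.
exact: IH.
Qed.

Lemma CkD k U f g : open U -> Ck k U f -> Ck k U g -> Ck k U (f + g).
Proof.
move=> oU; have cD (f1 g1 : 'rV[R]_m -> R) :
    continuous_on U f1 -> continuous_on U g1 -> continuous_on U (f1 + g1).
  by move=> cf cg x Ux; apply: continuousD; [exact: cf|exact: cg].
elim: k f g => [|k IH] f g; first exact: cD.
move=> [cf df] [cg dg]; split; first exact: cD.
move=> i; have [f1 f2] := df i; have [g1 g2] := dg i; split.
  by move=> x Ux; apply: derivableD; [exact: f1|exact: g1].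
apply: (@eq_Ck _ _ (partial i f + partial i g)) => //; last exact: IH.
by move=> x Ux; rewrite /partial deriveD//; [exact: f1|exact: g1].
Qed.

Lemma CkM k U f g : open U -> Ck k U f -> Ck k U g -> Ck k U (f * g).
Proof.
move=> oU; have cM (f1 g1 : 'rV[R]_m -> R) :
    continuous_on U f1 -> continuous_on U g1 -> continuous_on U (f1 * g1).
  by move=> cf cg x Ux; apply: continuousM; [exact: cf|exact: cg].
elim: k f g => [|k IH] f g; first exact: cM.
move=> Cf Cg; move: (Cf) (Cg) => [cf df] [cg dg]; split; first exact: cM.
move=> i; have [f1 f2] := df i; have [g1 g2] := dg i; split.
  by move=> x Ux; apply: derivableM; [exact: f1|exact: g1].
apply: (@eq_Ck _ _ (f * partial i g + g * partial i f)) => //.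
  by move=> x Ux; rewrite /partial deriveM//; [exact: f1|exact: g1].
by apply: CkD => //; apply: IH => //; exact: CkW.
Qed.

End Cinfty.

Record chart (R : realType) (m : nat) (T : topologicalType) := Chart {
  chart_dom : set T;
  chart_map : T -> 'rV[R]_m;
  chart_inv : 'rV[R]_m -> T;
  chart_dom_open : open chart_dom;
  chart_img_open : open (chart_map @` chart_dom);
  chart_mapK : {in chart_dom, cancel chart_map chart_inv};
  chart_map_continuous : {within chart_dom, continuous chart_map};
  chart_inv_continuous :
    {within chart_map @` chart_dom, continuous chart_inv} }.

Definition smooth_transition (R : realType) (m : nat) (T : topologicalType)
    (a b : chart R m T) :=
  forall i : 'I_m,
    Cinfty_on (chart_map a @` (chart_dom a `&` chart_dom b))
              (fun y => chart_map b (chart_inv a y) 0 i).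

(* The atlas need not be maximal: an atlas determines the smooth functions. *)
Record smooth_manifold (R : realType) (m : nat) := SmoothManifold {
  manifold_space :> topologicalType;
  manifold_hausdorff : hausdorff_space manifold_space;
  manifold_second_countable : @second_countable manifold_space;
  atlas : set (chart R m manifold_space);
  atlas_cover : forall p : manifold_space, exists2 a, atlas a & chart_dom a p;
  atlas_compatible : forall a b, atlas a -> atlas b -> smooth_transition a b }.

Section SmoothFunctions.
Context {R : realType} {m : nat} (M : smooth_manifold R m).

Definition is_smooth (f : M -> R) : Prop :=
  forall a, atlas a ->
    Cinfty_on (chart_map a @` chart_dom a) (fun y => f (chart_inv a y)).

Definition smooth_pred : {pred M -> R} := fun f => `[< is_smooth f >].

Lemma smooth_cst (c : R) : (fun=> c) \in smooth_pred.
Proof. by apply/asboolP => a _ k; exact: Ck_cst. Qed.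

Lemma smooth_subring_closed : subring_closed smooth_pred.
Proof.
have sM : {in smooth_pred &, forall f g, f * g \in smooth_pred}.
  move=> f g /asboolP sf /asboolP sg; apply/asboolP => a aa k.
  exact: (CkM (@chart_img_open _ _ _ a) (sf a aa k) (sg a aa k)).
split => //; first exact: smooth_cst.
move=> f g sf sg.
have /asboolP sN : (cst (-1) * g) \in smooth_pred by apply: sM (smooth_cst _) sg.
move/asboolP: sf => sf; apply/asboolP => a aa k.
have -> : f - g = f + cst (-1) * g :> (M -> R).
  by apply/funext => x /=; rewrite !fctE mulN1r.
exact: (CkD (@chart_img_open _ _ _ a) (sf a aa k) (sN a aa k)).
Qed.

HB.instance Definition _ :=
  GRing.isSubringClosed.Build (M -> R) smooth_pred smooth_subring_closed.

Record smooth_fun := SmoothFun {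
  smooth_val :> M -> R;
  smooth_valP : smooth_val \in smooth_pred }.

HB.instance Definition _ := [isSub for smooth_val].
HB.instance Definition _ := [Choice of smooth_fun by <:].
HB.instance Definition _ :=
  GRing.SubChoice_isSubComPzRing.Build (M -> R) smooth_pred smooth_fun
    smooth_subring_closed.

Definition csmooth (c : R) : smooth_fun := SmoothFun (smooth_cst c).

End SmoothFunctions.

Section VectorFields.
Context {R : realType} {m : nat} (M : smooth_manifold R m).
Local Notation C := (smooth_fun M).

(* A smooth vector field is a derivation of the R-algebra of smooth functions;
   its value at p is the tangent vector f |-> (X f)(p). *)
Definition is_derivation (D : C -> C^o) : Prop :=
  (forall (c : R) (f g : C), D (csmooth M c * f + g) = csmooth M c * D f + D g)
  /\ (forall f g : C, D (f * g) = D f * g + f * D g).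

Definition derivation_pred : {pred C -> C^o} := fun D => `[< is_derivation D >].

Lemma derivation_submod_closed : submod_closed derivation_pred.
Proof.
split.
  have z x : (0 : C -> C^o) x = 0 :> C by [].
  by apply/asboolP; split => [c f g|f g]; rewrite !z; ring.
move=> a D E /asboolP[D1 D2] /asboolP[E1 E2]; apply/asboolP.
have e x : (a *: D + E) x = a * D x + E x :> C by [].
by split => [c f g|f g]; rewrite !e ?D1 ?E1 ?D2 ?E2; ring.
Qed.

HB.instance Definition _ :=
  GRing.isSubmodClosed.Build C (C -> C^o) derivation_pred
    derivation_submod_closed.

Record vector_field := VectorField {
  vf_val : C -> C^o;
  vf_valP : vf_val \in derivation_pred }.

HB.instance Definition _ := [isSub for vf_val].
HB.instance Definition _ := [Choice of vector_field by <:].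
HB.instance Definition _ := [SubChoice_isSubLmodule of vector_field by <:].

Definition vf_app (X : vector_field) : C -> C := vf_val X.
Coercion vf_app : vector_field >-> Funclass.

Lemma vf_linear (X : vector_field) (c : R) (f g : C) :
  X (csmooth M c * f + g) = csmooth M c * X f + X g.
Proof. by have /asboolP[/(_ c f g)] := vf_valP X. Qed.

Lemma vf_leibniz (X : vector_field) (f g : C) : X (f * g) = X f * g + f * X g.
Proof. by have /asboolP[_ /(_ f g)] := vf_valP X. Qed.

Lemma vfD (X : vector_field) (f g : C) : X (f + g) = X f + X g.
Proof.
have := vf_linear X 1 f g; have -> : csmooth M 1 = 1 by exact/val_inj.
by rewrite !mul1r.
Qed.

Lemma lie_bracket_subproof (X Y : vector_field) :
  (fun f => X (Y f) - Y (X f)) \in derivation_pred.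
Proof.
apply/asboolP; split => [c f g|f g]; first by rewrite !vf_linear; ring.
by rewrite !(vf_leibniz, vfD); ring.
Qed.

Definition lie_bracket (X Y : vector_field) : vector_field :=
  VectorField (lie_bracket_subproof X Y).

End VectorFields.

Section TensorCalculus.
Context {R : realType} {m : nat} {M : smooth_manifold R m}.
Local Notation C := (smooth_fun M).
Local Notation X_ := (vector_field M).

(* Tensor fields are maps on vector fields that are multilinear over the ring
   of smooth functions; g_p(X_p, Y_p) is (g X Y) p. Nondegeneracy is required
   at each point. The index is locally constant, hence constant when M is
   connected, so it is not imposed separately. *)
Record pseudo_riemannian_metric := PseudoRiemannianMetric {
  prmetric_fun :> X_ -> X_ -> C;
  prmetric_linear : forall (a : C) (X Y Z : X_),
    prmetric_fun (a *: X + Y) Z = a * prmetric_fun X Z + prmetric_fun Y Z;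
  prmetric_sym : forall X Y : X_, prmetric_fun X Y = prmetric_fun Y X;
  prmetric_nondegenerate : forall (p : M) (X : X_),
    (forall Y : X_, prmetric_fun X Y p = 0) -> forall f : C, X f p = 0 }.

Record is_connection (nabla : X_ -> X_ -> X_) : Prop := {
  connection_linear : forall (a : C) (X Y Z : X_),
    nabla (a *: X + Y) Z = a *: nabla X Z + nabla Y Z;
  connectionD : forall X Y Z : X_, nabla X (Y + Z) = nabla X Y + nabla X Z;
  connection_leibniz : forall (a : C) (X Y : X_),
    nabla X (a *: Y) = X a *: Y + a *: nabla X Y }.

Record is_levi_civita (g : pseudo_riemannian_metric) (nabla : X_ -> X_ -> X_)
    : Prop := {
  levi_civita_connection : is_connection nabla;
  levi_civita_torsion_free : forall X Y : X_,
    nabla X Y - nabla Y X = lie_bracket X Y;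
  levi_civita_metric : forall X Y Z : X_,
    X (g Y Z) = g (nabla X Y) Z + g Y (nabla X Z) }.

Definition curvature (nabla : X_ -> X_ -> X_) (X Y Z : X_) : X_ :=
  nabla X (nabla Y Z) - nabla Y (nabla X Z) - nabla (lie_bracket X Y) Z.

Definition covariant_derivative (nabla : X_ -> X_ -> X_) (X : X_)
    (A : X_ -> X_) (Y : X_) : X_ :=
  nabla X (A Y) - A (nabla X Y).

Definition lie_derivative (X : X_) (A : X_ -> X_) (Y : X_) : X_ :=
  lie_bracket X (A Y) - A (lie_bracket X Y).

Definition exterior_derivative (eta : X_ -> C) (X Y : X_) : C :=
  csmooth M (2^-1) * (X (eta Y) - Y (eta X) - eta (lie_bracket X Y)).

End TensorCalculus.

Arguments pseudo_riemannian_metric {R m} M.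

Record almost_contact_pseudo_metric (R : realType) (m : nat)
    (M : smooth_manifold R m) := AlmostContactPseudoMetric {
  acm_phi : {linear vector_field M -> vector_field M};
  acm_xi : vector_field M;
  acm_eta : {linear vector_field M -> (smooth_fun M)^o};
  acm_g : pseudo_riemannian_metric M;
  acm_eps : R;
  acm_eps_sign : acm_eps = 1 \/ acm_eps = -1;
  acm_phi2 : forall X, acm_phi (acm_phi X) = - X + acm_eta X *: acm_xi;
  acm_eta_xi : acm_eta acm_xi = 1;
  acm_phi_xi : acm_phi acm_xi = 0;
  acm_eta_phi : forall X, acm_eta (acm_phi X) = 0;
  acm_compatible : forall X Y,
    acm_g (acm_phi X) (acm_phi Y) =
    acm_g X Y - csmooth M acm_eps * (acm_eta X * acm_eta Y) }.

Section Contact.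
Context {R : realType} {m : nat} {M : smooth_manifold R m}.
Variable S : almost_contact_pseudo_metric M.
Local Notation phi := (acm_phi S).
Local Notation xi := (acm_xi S).
Local Notation g := (acm_g S).

Definition fundamental_form (X Y : vector_field M) : smooth_fun M :=
  g X (phi Y).

Definition is_contact_pseudo_metric : Prop :=
  forall X Y, exterior_derivative (acm_eta S) X Y = fundamental_form X Y.

Definition contact_h (X : vector_field M) : vector_field M :=
  csmooth M (2^-1) *: lie_derivative xi phi X.

Definition contact_l (nabla : vector_field M -> vector_field M -> vector_field M)
    (X : vector_field M) : vector_field M :=
  curvature nabla X xi xi.

(* The xi-sectional curvature K(xi, X_p) of the plane spanned by xi_p and X_p.
   The factor (g X X) p is epsilon_X when X_p is a unit vector. *)
Definition xi_sectional_curvature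
    (nabla : vector_field M -> vector_field M -> vector_field M)
    (p : M) (X : vector_field M) : R :=
  acm_eps S * g X X p * g (curvature nabla xi X X) xi p.

End Contact.

(* Main.v *)
Require Import Defs.
From mathcomp Require Import all_boot all_order all_algebra.
From mathcomp Require Import all_classical all_reals all_analysis.
From mathcomp Require Import ring.

(** Everything is read off from the endomorphism A X = nabla_X xi of the tangent
    bundle, called the Reeb shape operator below.

    Since g(xi, xi) = eps is constant, A takes values in Ker eta; and d eta = Phi
    says exactly that the skew part of A is - eps phi
    ([reeb_shape_adjoint]), which gives A xi = 0.  As L_xi Phi = 0, the endomorphism
    P = nabla_xi phi is an expression in A and phi alone
    ([nabla_xi_phi_shape]).  On the other hand phi^2 = - I + eta (x) xi is parallel
    along xi, so P anticommutes with phi.  Comparing the two facts yields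
      phi A phi = A + 2 eps phi    ([phi_reeb_shape_phi]),
    and then P = 0 ([nabla_xi_phi]), h = phi A + eps phi^2 ([contact_hE]) and
    A^2 phi = phi A^2 ([reeb_shape_sqr_phi]).

    If nabla_xi h = 0, then nabla_xi A = 0, because A is recovered from phi A on
    Ker eta; hence the definition of the curvature collapses to l = - A^2
    ([contact_l_shape]).  If moreover nabla l = 0, then differentiating l xi = 0
    gives l (nabla_X xi) = 0, that is, A^3 = 0.  Finally
      0 = A^3 phi = A^2 (- phi A - 2 eps phi^2) = - phi A^3 + 2 eps A^2,
    so A^2 = 0 ([reeb_shape_sqr_eq0]), so l = 0, and K(xi, X) is up to sign
    g(l X, X) by the skew-symmetry of the curvature endomorphism.

    With h in place of A the middle step is the textbook argument: A = - eps phi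
    - phi h, l = - phi^2 - h^2, and l A = 0 says that (I - h^2)(eps I + h)
    vanishes on Ker eta; conjugating by phi, which anticommutes with h, changes
    the sign of h, and adding the two equations gives h^2 = I there. *)

Import GRing.Theory Num.Theory.
Local Open Scope classical_set_scope.
Local Open Scope ring_scope.

(** * Derivations and halving *)

Section VectorFieldTheory.
Context {R : realType} {m : nat} {M : smooth_manifold R m}.
Local Notation C := (smooth_fun M).
Implicit Types (X Y Z : vector_field M) (a f : C).

(** Reduces an identity between combinations of vector fields to one in the
    commutative ring of smooth functions, where [ring] applies. *)
Lemma vector_field_ext X Y : (forall f, X f = Y f) -> X = Y.
Proof. by move=> XY; apply: val_inj; apply/funext => f; exact: XY. Qed.

Lemma vf_addE X Y f : (X + Y) f = X f + Y f. Proof. by []. Qed.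
Lemma vf_oppE X f : (- X) f = - X f. Proof. by []. Qed.
Lemma vf_scaleE a X f : (a *: X) f = a * X f. Proof. by []. Qed.
Lemma vf_zeroE f : (0 : vector_field M) f = 0. Proof. by []. Qed.
Definition vfE := (vf_addE, vf_oppE, vf_scaleE, vf_zeroE).

Lemma vf0 X : X 0 = 0.
Proof. by apply: (addrI (X 0)); rewrite -vfD !addr0. Qed.

Lemma vfN X f : X (- f) = - X f.
Proof. by apply: (addrI (X f)); rewrite -vfD !subrr vf0. Qed.

Lemma vf_one X : X 1 = 0.
Proof.
by have := vf_leibniz X 1 1; rewrite !mulr1 mul1r -{1}[X 1]addr0 => /addrI.
Qed.

Lemma vf_csmoothM X (c : R) f : X (csmooth M c * f) = csmooth M c * X f.
Proof. by rewrite -[csmooth M c * f]addr0 vf_linear vf0 addr0. Qed.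

Lemma vf_csmooth X (c : R) : X (csmooth M c) = 0.
Proof. by rewrite -[csmooth M c]mulr1 vf_csmoothM vf_one mulr0. Qed.

Lemma csmooth_half : csmooth M 2^-1 + csmooth M 2^-1 = 1.
Proof.
apply/val_inj/funext => p.
by rewrite [LHS](_ : _ = 2^-1 + 2^-1 :> R)// [RHS](_ : _ = 1 :> R)//; field.
Qed.

Lemma csmooth_sign_sqr (c : R) :
  c = 1 \/ c = -1 -> csmooth M c * csmooth M c = 1.
Proof.
move=> c1; apply/val_inj/funext => p.
rewrite [LHS](_ : _ = c * c :> R)// [RHS](_ : _ = 1 :> R)//.
by case: c1 => ->; ring.
Qed.

Lemma half_double (V : lmodType C) (x : V) : csmooth M 2^-1 *: (x + x) = x.
Proof. by rewrite scalerDr -scalerDl csmooth_half scale1r. Qed.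

(** Factors 2 are written as sums throughout, so that they are cancelled in
    modules over smooth functions, and in that ring itself, by this lemma. *)
Lemma double_inj (V : lmodType C) (x y : V) : x + x = y + y -> x = y.
Proof. by move=> xy; rewrite -(half_double V x) xy half_double. Qed.

Lemma lie_bracketE X Y f : lie_bracket X Y f = X (Y f) - Y (X f).
Proof. by []. Qed.

Lemma lie_bracket_jacobi X Y Z :
  lie_bracket X (lie_bracket Y Z) =
  lie_bracket (lie_bracket X Y) Z + lie_bracket Y (lie_bracket X Z).
Proof.
apply: vector_field_ext => f.
by rewrite !(vfE, lie_bracketE, vfD, vfN); ring.
Qed.

End VectorFieldTheory.

(** * Metrics and Levi-Civita connections *)

Section MetricTheory.
Context {R : realType} {m : nat} {M : smooth_manifold R m}.
Local Notation C := (smooth_fun M).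
Variable g : pseudo_riemannian_metric M.
Implicit Types (X Y Z W : vector_field M) (a : C).

Lemma metricDl X Y Z : g (X + Y) Z = g X Z + g Y Z.
Proof. by rewrite -[X]scale1r prmetric_linear mul1r scale1r. Qed.

Lemma metric0l Z : g 0 Z = 0.
Proof. by apply: (addrI (g 0 Z)); rewrite -metricDl !addr0. Qed.

Lemma metricZl a X Z : g (a *: X) Z = a * g X Z.
Proof. by rewrite -[a *: X]addr0 prmetric_linear metric0l addr0. Qed.

Lemma metricNl X Z : g (- X) Z = - g X Z.
Proof. by rewrite -scaleN1r metricZl mulN1r. Qed.

Lemma metricDr X Y Z : g Z (X + Y) = g Z X + g Z Y.
Proof. by rewrite !(prmetric_sym g Z) metricDl. Qed.

Lemma metric0r Z : g Z 0 = 0.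
Proof. by rewrite prmetric_sym metric0l. Qed.

Lemma metricZr a X Z : g Z (a *: X) = a * g Z X.
Proof. by rewrite !(prmetric_sym g Z) metricZl. Qed.

Lemma metricNr X Z : g Z (- X) = - g Z X.
Proof. by rewrite !(prmetric_sym g Z) metricNl. Qed.

Definition metricE := (metricDl, metricDr, metricNl, metricNr, metricZl,
  metricZr, metric0l, metric0r).

(** Pointwise nondegeneracy, with the tangent vector at p read as the values at
    p of the derivation, separates vector fields. *)
Lemma metric_inj X Y : (forall Z, g Z X = g Z Y) -> X = Y.
Proof.
move=> XY; apply/eqP; rewrite -subr_eq0; apply/eqP.
apply: vector_field_ext => f; apply/val_inj/funext => p.
apply: (@prmetric_nondegenerate _ _ _ g p) => Z.
by rewrite prmetric_sym metricDr metricNr XY subrr.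
Qed.

Section LeviCivita.
Variable nabla : vector_field M -> vector_field M -> vector_field M.
Hypothesis nabla_LC : is_levi_civita g nabla.
Let nabla_conn := levi_civita_connection nabla_LC.

Lemma nablaDl X Y Z : nabla (X + Y) Z = nabla X Z + nabla Y Z.
Proof. by rewrite -[X]scale1r (connection_linear nabla_conn) !scale1r. Qed.

Lemma nabla0l Z : nabla 0 Z = 0.
Proof. by apply: (addrI (nabla 0 Z)); rewrite -nablaDl !addr0. Qed.

Lemma nablaZl a X Z : nabla (a *: X) Z = a *: nabla X Z.
Proof.
by rewrite -[a *: X]addr0 (connection_linear nabla_conn) nabla0l addr0.
Qed.

Lemma nablaNl X Z : nabla (- X) Z = - nabla X Z.
Proof. by rewrite -scaleN1r nablaZl scaleN1r. Qed.

Lemma nabla0r X : nabla X 0 = 0.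
Proof.
by apply: (addrI (nabla X 0)); rewrite -(connectionD nabla_conn) !addr0.
Qed.

Lemma nablaNr X Y : nabla X (- Y) = - nabla X Y.
Proof.
by apply: (addrI (nabla X Y)); rewrite -(connectionD nabla_conn) !subrr nabla0r.
Qed.

Lemma nabla_csmooth X (c : R) Y :
  nabla X (csmooth M c *: Y) = csmooth M c *: nabla X Y.
Proof.
by rewrite (connection_leibniz nabla_conn) vf_csmooth scale0r add0r.
Qed.

(** The curvature endomorphism acts as a derivation on tensors, by 0 on functions
    and on g; applied to the function g(Z, W) this is the skew-symmetry. *)
Lemma curvature_metric_skew X Y Z W :
  g (curvature nabla X Y Z) W = - g Z (curvature nabla X Y W).
Proof.
have := lie_bracketE X Y (g Z W).
rewrite !(levi_civita_metric nabla_LC, vfD) => /esym/eqP.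
rewrite -subr_eq0 => /eqP bracket0.
apply/eqP; rewrite -addr_eq0 -[X in _ == X]bracket0 /curvature !metricE.
by apply/eqP; ring.
Qed.

End LeviCivita.
End MetricTheory.

(** * Almost contact pseudo-metric structures *)

Section AlmostContact.
Context {R : realType} {m : nat} {M : smooth_manifold R m}.
Variable S : almost_contact_pseudo_metric M.
Local Notation C := (smooth_fun M).
Local Notation phi := (acm_phi S).
Local Notation xi := (acm_xi S).
Local Notation eta := (acm_eta S).
Local Notation g := (acm_g S).
Local Notation e := (csmooth M (acm_eps S)).
Implicit Types X Y Z : vector_field M.

Lemma acm_eps_sqr : e * e = 1.
Proof. exact: csmooth_sign_sqr (acm_eps_sign S). Qed.

Lemma metric_xi X : g X xi = e * eta X.
Proof.
have /eqP := acm_compatible S X xi.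
by rewrite acm_phi_xi metric0r acm_eta_xi mulr1 eq_sym subr_eq0 => /eqP.
Qed.

Lemma eta_metric_xi X : eta X = e * g X xi.
Proof. by rewrite metric_xi mulrA acm_eps_sqr mul1r. Qed.

Lemma phi_skew X Y : g (phi X) Y = - g X (phi Y).
Proof.
have := acm_compatible S X (phi Y).
rewrite acm_phi2 acm_eta_phi !metricE metric_xi acm_eta_phi !mulr0 addr0 subr0.
by move=> <-; rewrite opprK.
Qed.

Lemma phi3 X : phi (phi (phi X)) = - phi X.
Proof. by rewrite acm_phi2 acm_eta_phi scale0r addr0. Qed.

Lemma phi2_horizontal X : eta X = 0 -> phi (phi X) = - X.
Proof. by move=> X0; rewrite acm_phi2 X0 scale0r addr0. Qed.

Variable nabla : vector_field M -> vector_field M -> vector_field M.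
Hypothesis nabla_LC : is_levi_civita g nabla.
Let nabla_conn := levi_civita_connection nabla_LC.

(** The name follows hypersurface theory, where the covariant derivative of the
    unit normal is, up to sign, the shape operator. *)
Definition reeb_shape X := nabla X xi.
Local Notation A := reeb_shape.

Lemma reeb_shapeD X Y : A (X + Y) = A X + A Y.
Proof. exact: (nablaDl _ _ nabla_LC) _ _ _. Qed.

Lemma reeb_shapeN X : A (- X) = - A X.
Proof. exact: (nablaNl _ _ nabla_LC) _ _. Qed.

Lemma reeb_shapeZ a X : A (a *: X) = a *: A X.
Proof. exact: (nablaZl _ _ nabla_LC) _ _ _. Qed.

Lemma reeb_shape0 : A 0 = 0.
Proof. exact: (nabla0l _ _ nabla_LC) _. Qed.

(** Differentiating the constant function g(xi, xi). *)
Lemma eta_reeb_shape X : eta (A X) = 0.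
Proof.
have gxi : g xi xi = e by rewrite metric_xi acm_eta_xi mulr1.
have := levi_civita_metric nabla_LC X xi xi.
rewrite gxi vf_csmooth (prmetric_sym g xi) => gA.
rewrite eta_metric_xi; suff -> : g (A X) xi = 0 by rewrite mulr0.
by apply: (double_inj C^o); rewrite addr0.
Qed.

Lemma lie_bracket_xi X : lie_bracket xi X = nabla xi X - A X.
Proof. by rewrite -(levi_civita_torsion_free nabla_LC). Qed.

(** * The Reeb shape operator of a contact structure *)

Section Contact.
Hypothesis S_contact : is_contact_pseudo_metric S.

Lemma contact_twice_d_eta X Y :
  X (eta Y) - Y (eta X) - eta (lie_bracket X Y) = g X (phi Y) + g X (phi Y).
Proof.
rewrite -(S_contact X Y : _ = g X (phi Y)) /exterior_derivative.
by rewrite -mulrDl csmooth_half mul1r.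
Qed.

(** For a torsion-free metric connection, 2 d eta (X, Y) is
    eps (g (A X) Y - g X (A Y)), so the contact condition prescribes the skew
    part of A. *)
Lemma reeb_shape_adjoint X Y :
  g (A X) Y = g X (A Y) - (e + e) * g (phi X) Y.
Proof.
have := contact_twice_d_eta X Y.
rewrite !eta_metric_xi !vf_csmoothM !(levi_civita_metric nabla_LC).
rewrite -(levi_civita_torsion_free nabla_LC) !metricE.
rewrite -!/(A _) (prmetric_sym g Y (A X)) phi_skew => dE.
have {dE} dE : e * (g (A X) Y - g X (A Y)) = g X (phi Y) + g X (phi Y).
  by rewrite -dE; ring.
have : (e * e) * (g (A X) Y - g X (A Y)) = (e + e) * g X (phi Y).
  by rewrite -mulrA dE; ring.
rewrite acm_eps_sqr mul1r => /eqP; rewrite subr_eq => /eqP ->; ring.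
Qed.

Lemma reeb_shape_xi : A xi = 0.
Proof.
apply: (metric_inj g) => Z.
rewrite prmetric_sym reeb_shape_adjoint acm_phi_xi !metricE mulr0 subr0.
by rewrite prmetric_sym metric_xi eta_reeb_shape mulr0.
Qed.

(** L_xi eta = 0, because d eta (xi, -) = Phi (xi, -) = 0 and eta xi = 1. *)
Lemma reeb_eta_bracket X : xi (eta X) = eta (lie_bracket xi X).
Proof.
have := contact_twice_d_eta xi X.
rewrite acm_eta_xi vf_one subr0 prmetric_sym metric_xi acm_eta_phi mulr0 addr0.
by move/eqP; rewrite subr_eq0 => /eqP.
Qed.

Lemma reeb_eta_nabla X : xi (eta X) = eta (nabla xi X).
Proof.
by rewrite reeb_eta_bracket lie_bracket_xi raddfB/= eta_reeb_shape subr0.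
Qed.

(** L_xi Phi = L_xi (d eta) = d (L_xi eta) = 0; the interchange of L_xi and d is
    the Jacobi identity. *)
Lemma reeb_preserves_fundamental_form X Y :
  xi (g X (phi Y)) = g (lie_bracket xi X) (phi Y) + g X (phi (lie_bracket xi Y)).
Proof.
apply: (double_inj C^o); rewrite /= addrACA -!contact_twice_d_eta -vfD.
rewrite -contact_twice_d_eta !vfD !vfN -!reeb_eta_bracket !lie_bracketE.
rewrite (reeb_eta_bracket (lie_bracket X Y)) lie_bracket_jacobi raddfD /=.
ring.
Qed.

(** Writing each [xi, X] as nabla_xi X - A X turns L_xi Phi = 0 into a formula for
    nabla_xi phi. *)
Lemma nabla_xi_phi_shape Y :
  nabla xi (phi Y) - phi (nabla xi Y) =
  - (A (phi Y) + phi (A Y)) - (e + e) *: phi (phi Y).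
Proof.
apply: (metric_inj g) => X.
have := reeb_preserves_fundamental_form X Y.
rewrite (levi_civita_metric nabla_LC) !lie_bracket_xi raddfB /= !metricE.
rewrite (reeb_shape_adjoint X (phi Y)) (phi_skew X (phi Y)).
move=> /eqP; rewrite -subr_eq0 => /eqP LE.
by apply/eqP; rewrite -subr_eq0 -LE; apply/eqP; ring.
Qed.

(** phi^2 is parallel along xi, as eta and xi are; so nabla_xi phi anticommutes
    with phi, and substituting [nabla_xi_phi_shape] gives twice this identity. *)
Lemma phi_reeb_shape_phi Y : phi (A (phi Y)) = A Y + (e + e) *: phi Y.
Proof.
(* The Leibniz rule for nabla_xi (phi o phi). *)
have anti : (nabla xi (phi (phi Y)) - phi (nabla xi (phi Y)))
    + phi (nabla xi (phi Y) - phi (nabla xi Y)) = 0.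
  rewrite raddfB /= !acm_phi2 (connectionD nabla_conn) (nablaNr _ _ nabla_LC).
  rewrite (connection_leibniz nabla_conn) -/(A xi) reeb_shape_xi reeb_eta_nabla.
  by apply: vector_field_ext => f; rewrite !vfE; ring.
apply: double_inj; move: anti.
rewrite !nabla_xi_phi_shape raddfB raddfN (raddfD phi (A (phi Y))) /=.
rewrite (linearZ _ (phi (phi Y))) /= !phi3.
rewrite (phi2_horizontal (A Y)) ?eta_reeb_shape//.
rewrite {1}acm_phi2 reeb_shapeD reeb_shapeN reeb_shapeZ reeb_shape_xi scaler0.
move=> /eqP; rewrite -subr_eq0 subr0 => /eqP anti.
apply/eqP; rewrite -subr_eq0 -oppr_eq0 -anti; apply/eqP.
by apply: vector_field_ext => f; rewrite !vfE; ring.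
Qed.

Lemma reeb_shape_phi Y : A (phi Y) = - phi (A Y) - (e + e) *: phi (phi Y).
Proof.
rewrite -[LHS]opprK -(phi2_horizontal (A (phi Y))) ?eta_reeb_shape//.
by rewrite phi_reeb_shape_phi raddfD /= linearZ /= opprD.
Qed.

Lemma nabla_xi_phi Y : nabla xi (phi Y) = phi (nabla xi Y).
Proof.
apply/eqP; rewrite -subr_eq0 nabla_xi_phi_shape reeb_shape_phi; apply/eqP.
by apply: vector_field_ext => f; rewrite !vfE; ring.
Qed.

Lemma contact_hE Y : contact_h S Y = phi (A Y) + e *: phi (phi Y).
Proof.
rewrite /contact_h /lie_derivative -[RHS]half_double; congr (_ *: _).
rewrite !lie_bracket_xi nabla_xi_phi raddfB /= reeb_shape_phi.
by apply: vector_field_ext => f; rewrite !vfE; ring.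
Qed.

Lemma reeb_shape_sqr_phi Y : A (A (phi Y)) = phi (A (A Y)).
Proof.
rewrite reeb_shape_phi reeb_shapeD !reeb_shapeN reeb_shapeZ reeb_shape_phi.
rewrite (phi2_horizontal (A Y)) ?eta_reeb_shape// acm_phi2.
rewrite reeb_shapeD reeb_shapeN reeb_shapeZ reeb_shape_xi.
by apply: vector_field_ext => f; rewrite !vfE; ring.
Qed.

(** Expand A^2 (A phi) by [reeb_shape_phi]: A^2 commutes with phi, so the term
    phi A^3 drops out and 2 eps A^2 remains. *)
Lemma reeb_shape_sqr_eq0 : (forall X, A (A (A X)) = 0) -> forall X, A (A X) = 0.
Proof.
move=> A3 X; have := A3 (phi X).
rewrite reeb_shape_phi !(reeb_shapeD, reeb_shapeN, reeb_shapeZ) !reeb_shape_sqr_phi.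
rewrite A3 raddf0 oppr0 add0r.
rewrite phi2_horizontal ?eta_reeb_shape// scalerN opprK => A2.
apply: double_inj; rewrite addr0 -[LHS]scale1r -acm_eps_sqr.
have <- : e *: ((e + e) *: A (A X)) = (e * e) *: (A (A X) + A (A X)).
  by rewrite !scalerA mulrDr scalerDl scalerDr.
by rewrite A2 scaler0.
Qed.

(** * Consequences of the parallelism of h along xi *)

Section ParallelH.
Hypothesis nabla_xi_h : forall Y, covariant_derivative nabla xi (contact_h S) Y = 0.

(** By [contact_hE] and nabla_xi phi = 0, phi kills (nabla_xi A) Y; that field is
    also in Ker eta, where phi is injective. *)
Lemma nabla_xi_shape Y : nabla xi (A Y) = A (nabla xi Y).
Proof.
have := nabla_xi_h Y; rewrite /covariant_derivative !contact_hE.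
rewrite (connectionD nabla_conn) (nabla_csmooth _ _ nabla_LC) !nabla_xi_phi.
rewrite opprD addrACA subrr addr0 -raddfB /= => phiD.
set D := nabla xi (A Y) - A (nabla xi Y) in phiD.
have etaD : eta D = 0.
  by rewrite raddfB /= -reeb_eta_nabla !eta_reeb_shape vf0 subr0.
apply/eqP; rewrite -subr_eq0 -/D -[D]opprK -(phi2_horizontal D etaD) phiD.
by rewrite raddf0 oppr0.
Qed.

Lemma contact_l_shape Y : contact_l S nabla Y = - A (A Y).
Proof.
rewrite /contact_l /curvature -(levi_civita_torsion_free nabla_LC).
rewrite -!/(A _) reeb_shape_xi (nabla0r _ _ nabla_LC) nabla_xi_shape.
rewrite reeb_shapeD reeb_shapeN.
by apply: vector_field_ext => f; rewrite !vfE; ring.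
Qed.

End ParallelH.
End Contact.
End AlmostContact.

(** * Vanishing of the xi-sectional curvatures *)

Theorem theorem5p6 (R : realType) (n : nat)
  (M : smooth_manifold R (n.*2.+1)) (M_connected : connected [set: M])
  (S : almost_contact_pseudo_metric M)
  (S_contact : is_contact_pseudo_metric S)
  (nabla : vector_field M -> vector_field M -> vector_field M)
  (nabla_LC : is_levi_civita (acm_g S) nabla)
  (nabla_xi_h : forall Y : vector_field M,
     covariant_derivative nabla (acm_xi S) (contact_h S) Y = 0)
  (nabla_l : forall X Y : vector_field M,
     covariant_derivative nabla X (contact_l S nabla) Y = 0) :
  forall (p : M) (X : vector_field M),
    acm_eta S X p = 0 ->
    acm_g S X X p = 1 \/ acm_g S X X p = -1 ->
    xi_sectional_curvature S nabla p X = 0.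
Proof.
move=> p X _ _.
pose A := reeb_shape S nabla.
have lE Y : contact_l S nabla Y = - A (A Y) by exact: contact_l_shape.
have A0 : A 0 = 0 by exact: reeb_shape0.
have Axi : A (acm_xi S) = 0 by exact: reeb_shape_xi.
(* nabla_Y l = 0 evaluated at xi, using l xi = 0. *)
have A3 Y : A (A (A Y)) = 0.
  have := nabla_l Y (acm_xi S); rewrite /covariant_derivative !lE.
  by rewrite Axi A0 oppr0 (nabla0r _ _ nabla_LC) sub0r opprK.
have l0 Y : contact_l S nabla Y = 0.
  by rewrite lE [A (A Y)](reeb_shape_sqr_eq0 _ _ nabla_LC S_contact A3) oppr0.
rewrite /xi_sectional_curvature (curvature_metric_skew _ _ nabla_LC).
have -> : curvature nabla (acm_xi S) X (acm_xi S) = - contact_l S nabla X.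
  rewrite /contact_l /curvature.
  rewrite -!(levi_civita_torsion_free nabla_LC) !(nablaDl _ _ nabla_LC).
  rewrite !(nablaNl _ _ nabla_LC).
  by apply: vector_field_ext => f; rewrite !vfE; ring.
by rewrite l0 oppr0 metric0r oppr0 mulr0.
Qed.
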